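(* Let $k$ be an algebraically closed field of characteristic $p>0$ and let $X\subset\mathbb P^3_k$ be a smooth extremal surface of degree $d$. If $d>10$ or $d<5$, then every double $2d$ on $X$ is a union of two quadric configurations on $X$; that is, its set of $4d$ lines is the union of the sets of lines of two quadric configurations on $X$. Moreover, if $d\ge 5$ and two quadrics determine some double $2d$ on $X$, then no other pair of quadrics determines the same double $2d$.
   Context: $k$ is an algebraically closed field of characteristic $p>0$. A Frobenius form is a homogeneous polynomial of degree $q+1$, where $q=p^e$ for some $e\ge 1$, of the form $\sum_i x_i^{q}L_i$ with each $L_i$ a linear form. An extremal surface of degree $d=q+1$ is a surface in $\mathbb P^3_k$ defined by a Frobenius form of degree $d$ in four variables. A double $2d$ is a collection of two sets $\mathcal A$ and $\mathcal B$, each consisting of $2d$ lines in $\mathbb P^3_k$, such that (1) each line in $\mathcal A$ (resp. $\mathcal B$) is skew to every other line in $\mathcal A$ (resp. $\mathcal B$); and (2) each line in $\mathcal A$ (resp. $\mathcal B$) intersects exactly $d+2$ lines in $\mathcal B$ (resp. $\mathcal A$). It is on $X$ if all its lines lie on $X$. A quadric configuration on a surface $X\subset \mathbb P^3$ of degree $d\ge3$ is a collection of $2d$ lines on $X$ consisting of two sets of $d$ pairwise skew lines such that each line in either set meets every line of the other set. Such a configuration is equal to $X\cap Q$ for a unique smooth quadric surface $Q$; one says $Q$ defines the quadric configuration. A pair of quadrics $\{Q,Q'\}$, each defining a quadric configuration on $X$, determines a double $2d$ on $X$ with sets $\mathcal A,\mathcal B$ if the set of lines $\mathcal A\cup\mathcal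 B$ is the union of the two quadric configurations $X\cap Q$ and $X\cap Q'$. *)

(* Defs.v *)
From HB Require Import structures.
From mathcomp Require Import all_boot all_order all_algebra.
From mathcomp Require Import finmap.
From mathcomp Require Import mpoly.

Set Implicit Arguments.
Unset Strict Implicit.
Unset Printing Implicit Defensive.

Import GRing.Theory.

Local Open Scope ring_scope.
Local Open Scope fset_scope.

(* A point of P^3 is given by its nonzero coordinate vectors v : 'rV[k]_4, and
   a line of P^3 is a 2-dimensional linear subspace of k^4. *)
Definition line (k : fieldType) := {l : {vspace 'rV[k]_4} | \dim l == 2%N}.

HB.instance Definition _ (k : fieldType) := Choice.on (line k).

Definition meets (k : fieldType) (l m : line k) : bool :=
  (val l :&: val m)%VS != 0%VS.

Definition skew (k : fieldType) (l m : line k) : bool := ~~ meets l m.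

Definition pairwise_skew (k : fieldType) (A : {fset line k}) : Prop :=
  forall l m, l \in A -> m \in A -> l != m -> skew l m.

(* Surfaces are given by a nonzero homogeneous F, up to nonzero scalars. *)
Definition vanishes_at (k : fieldType) (F : {mpoly k[4]}) (v : 'rV[k]_4) : Prop :=
  F.@[v 0] = 0.

(* Jacobian criterion on the cone; F itself is kept in the condition because
   the Euler relation fails when p divides the degree. *)
Definition smooth_surface (k : fieldType) (F : {mpoly k[4]}) : Prop :=
  forall v : 'rV[k]_4, v != 0 -> vanishes_at F v ->
    exists i : 'I_4, (mderiv i F).@[v 0] != 0.

Definition same_surface (k : fieldType) (F G : {mpoly k[4]}) : Prop :=
  exists2 c : k, c != 0 & G = c *: F.

(* Over an infinite field, vanishing at all vectors of l is the same as the
   scheme-theoretic containment of l in the surface. *)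
Definition line_on (k : fieldType) (F : {mpoly k[4]}) (l : line k) : Prop :=
  forall v : 'rV[k]_4, v \in val l -> vanishes_at F v.

Definition lines_on (k : fieldType) (F : {mpoly k[4]}) (A : {fset line k}) : Prop :=
  forall l, l \in A -> line_on F l.

Definition frobenius_form (k : fieldType) (q n : nat) (F : {mpoly k[n]}) : Prop :=
  exists2 L : 'I_n -> {mpoly k[n]},
    forall i, L i \is 1.-homog & F = \sum_(i < n) 'X_i ^+ q * L i.

Definition extremal_surface (k : fieldType) (p d : nat) (F : {mpoly k[4]}) : Prop :=
  F != 0 /\
  exists e : nat,
    [/\ (1 <= e)%N, d = (p ^ e).+1 & frobenius_form (p ^ e) F].

(* When 2 <= d, A and B are automatically disjoint: a line l in both would meet
   no line of B but itself. *)
Definition double_2d (k : fieldType) (d : nat) (A B : {fset line k}) : Prop :=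
  [/\ #|` A| = (2 * d)%N /\ #|` B| = (2 * d)%N,
      pairwise_skew A /\ pairwise_skew B,
      forall l, l \in A -> #|` [fset m in B | meets l m]| = (d + 2)%N
    & forall m, m \in B -> #|` [fset l in A | meets m l]| = (d + 2)%N].

Definition quadric_configuration (k : fieldType) (d : nat) (F : {mpoly k[4]})
    (C : {fset line k}) : Prop :=
  [/\ #|` C| = (2 * d)%N, lines_on F C
    & exists M N : {fset line k},
      [/\ C = M `|` N,
          #|` M| = d /\ #|` N| = d,
          pairwise_skew M /\ pairwise_skew N
        & forall l m, l \in M -> m \in N -> meets l m]].

Definition smooth_quadric (k : fieldType) (Q : {mpoly k[4]}) : Prop :=
  [/\ Q != 0, Q \is 2.-homog & smooth_surface Q].

(* The equality of X \cap Q with the union of the lines of C is one of sets of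
   points. For a quadric configuration C it implies the equality of schemes:
   X \cap Q has type (d, d) on Q and C has d lines in each ruling. *)
Definition defines_configuration (k : fieldType) (d : nat)
    (F Q : {mpoly k[4]}) (C : {fset line k}) : Prop :=
  [/\ smooth_quadric Q, quadric_configuration d F C
    & forall v : 'rV[k]_4, v != 0 ->
        (vanishes_at F v /\ vanishes_at Q v) <->
        (exists2 l : line k, l \in C & v \in val l)].

Definition pair_determines (k : fieldType) (d : nat) (F Q Q' : {mpoly k[4]})
    (A B : {fset line k}) : Prop :=
  exists C C' : {fset line k},
    [/\ defines_configuration d F Q C,
        defines_configuration d F Q' C'
      & A `|` B = C `|` C'].

(* {Q1, Q2} = {R1, R2} as unordered pairs of surfaces. *)
Definition same_pair (k : fieldType) (Q1 Q2 R1 R2 : {mpoly k[4]}) : Prop :=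
  (same_surface Q1 R1 /\ same_surface Q2 R2) \/
  (same_surface Q1 R2 /\ same_surface Q2 R1).

(* Main.v *)
(* If three pairwise skew lines a_i all meet three pairwise skew lines b_j, these
   six lines lie on a quadric, and any x meeting the b_j meets any y meeting the
   a_i.  So in the bipartite graph of incidences between A and B, the set D of
   common neighbours of a triple in A, if it has at least 3 elements, and the set
   C of common neighbours of D form a biclique such that a line of A outside C
   meets at most 2 lines of D, and symmetrically.  Counting edges between A and D
   and between C and B then forces |C| = |D| = d as soon as |D| >= 5 or |D| >= d.
   The d remaining lines of A meet at most 2 lines of D, hence all d remaining
   lines of B: this is the second quadric configuration.  A triple with at least 5
   common neighbours exists when d > 10 because the average over triples,
   (d+2)(d+1)d / (2(2d-1)(d-1)), exceeds 4 exactly from d = 11 on; for d = 3, 4 a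
   triple with d common neighbours is found by hand.

   For uniqueness, of the d >= 5 lines of a ruling of the new configuration three
   lie on Q1 or on Q2, and a quadric is determined by three skew lines on it.  Both
   new quadrics cannot coincide, since no line is covered by finitely many other
   lines. *)

Require Import Defs.
From mathcomp Require Import all_boot all_order all_algebra.
From mathcomp Require Import finmap.
From mathcomp Require Import mpoly.
From mathcomp Require Import zify ring.

Set Implicit Arguments.
Unset Strict Implicit.
Unset Printing Implicit Defensive.

Import GRing.Theory.
(* all_algebra exports another [skew]. *)
Import Defs.

(** * Bipartite graphs in which all degrees are N + 2 *)

Definition K33_closed (T U : eqType) (r : T -> U -> bool) : Prop :=
  forall a1 a2 a3 b1 b2 b3 x y,
    uniq [:: a1; a2; a3] -> uniq [:: b1; b2; b3] ->
    allrel r [:: a1; a2; a3] [:: b1; b2; b3] ->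
    all (r x) [:: b1; b2; b3] -> all (r^~ y) [:: a1; a2; a3] -> r x y.

(* If M is the larger of x and y, the hypotheses give (M - 4)(N - M) <= 0, so
   M = N; the other one is then N because (N - 2)(N - y) <= 0. *)
Lemma biclique_arith (N x y : nat) :
  2 < N -> x <= N -> y <= N -> 4 < y \/ N <= y ->
  y * (N + 2) + 2 * x <= x * y + 4 * N ->
  x * (N + 2) + 2 * y <= x * y + 4 * N ->
  x = N /\ y = N.
Proof.
move=> N2 xN yN y5 h1 h2.
have [yeq|yne] := eqVneq y N.
  by split=> //; subst y; apply/eqP; rewrite eqn_leq xN /=; nia.
have [xeq|xne] := eqVneq x N.
  by split=> //; subst x; apply/eqP; rewrite eqn_leq yN /=; nia.
exfalso.
(* Both [x] and [y] are now below [N], so [y] is at least 5. Nonnegative slacks replace the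
   differences, which leaves polynomial inequalities without subtraction. *)
have [u Nu] : exists u, N = u + y.+1 by exists (N - y.+1); lia.
have [w Nw] : exists w, N = w + x.+1 by exists (N - x.+1); lia.
have [le_xy|lt_yx] := leqP x y.
  have [z zy] : exists z, y = x + z by exists (y - x); lia.
  have [t tz] : exists t, y = 5 + t by exists (y - 5); lia.
  subst N; nia.
have [z zy] : exists z, x = y + z by exists (x - y); lia.
have [t tz] : exists t, y = 5 + t by exists (y - 5); lia.
nia.
Qed.

Section Biregular.

Variables (T U : finType) (r : T -> U -> bool) (N : nat).
Hypotheses (N_gt2 : 2 < N) (cardT : #|T| = 2 * N) (cardU : #|U| = 2 * N).
Hypothesis degT : forall a, #|[set b | r a b]| = N + 2.
Hypothesis degU : forall b, #|[set a | r a b]| = N + 2.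

(** A vertex outside [C] has at least [N] neighbours outside [D], which gives the first and last
    claims; such a vertex exists because [C] has at most N + 2 < 2N elements. The middle claim
    counts the edges between [T] and [D]. *)
Lemma closed_biclique_bounds (C : {set T}) (D : {set U}) :
    0 < #|D| ->
    {in C & D, forall a b, r a b} ->
    (forall a, a \notin C -> #|D :&: [set b | r a b]| <= 2) ->
  [/\ #|D| <= N, #|D| * (N + 2) + 2 * #|C| <= #|C| * #|D| + 4 * N
    & #|D| = N -> {in ~: C & ~: D, forall a b, r a b}].
Proof.
move=> /card_gt0P[b0 b0D] CD outC.
have C_le : #|C| <= N + 2.
  by rewrite -(degU b0) subset_leq_card //; apply/subsetP=> a aC; rewrite inE CD.
have out_ge a : a \notin C -> N <= #|~: D :&: [set b | r a b]|.
  move=> /outC; have := cardsID D [set b | r a b].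
  by rewrite degT setDE [_ :&: ~: D]setIC [_ :&: D]setIC; lia.
have cD : #|~: D| = 2 * N - #|D| by rewrite cardsCs setCK cardU.
split.
- have /card_gt0P[a] : 0 < #|~: C| by rewrite cardsCs setCK cardT; lia.
  rewrite inE => /out_ge /leq_trans/(_ (subset_leq_card (subsetIl _ _))).
  by have := max_card (mem D); rewrite cardU cD; lia.
- have cT : #|~: C| = 2 * N - #|C| by rewrite cardsCs setCK cardT.
  have cle : #|C| <= 2 * N by rewrite -cardT max_card.
  have -> : #|D| * (N + 2) = \sum_(a : T) #|D :&: [set b | r a b]|.
    rewrite -sum_nat_const.
    under eq_bigr => b _ do rewrite -(degU b) -sum1dep_card big_mkcond /=.
    rewrite exchange_big /=; apply: eq_bigr => a _.
    rewrite -sum1_card -big_mkcondr; apply: eq_bigl => b.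
    by rewrite !inE.
  (* A vertex of [C] contributes at most [#|D|] edges, any other vertex at most 2. *)
  rewrite (bigID (mem C)) /=.
  have : \sum_(a in C) #|D :&: [set b | r a b]| <= \sum_(a in C) #|D|.
    by apply: leq_sum => a _; rewrite subset_leq_card ?subsetIl.
  have : \sum_(a | a \notin C) #|D :&: [set b | r a b]| <= \sum_(a in ~: C) 2.
    by under [leqRHS]eq_bigl do rewrite inE; apply: leq_sum => a /outC.
  by rewrite !sum_nat_const cT; lia.
- move=> DN a b; rewrite inE => /out_ge le_out bD.
  have /eqP : ~: D :&: [set b | r a b] == ~: D.
    by rewrite eqEcard subsetIl cD DN; lia.
  by move=> /setP/(_ b); move: bD; rewrite !inE => ->.
Qed.

Definition common (S : {set T}) : {set U} := [set b | [forall a in S, r a b]].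

(** Pairs of a triple and a common neighbour [b] are counted by [b]: the triple is any 3-subset of
    the N + 2 neighbours of [b]. *)
Lemma sum_common :
  \sum_(S : {set T} | #|S| == 3) #|common S| = 2 * N * 'C(N + 2, 3).
Proof.
under eq_bigr => S _ do rewrite -sum1_card.
rewrite (exchange_big_dep predT) //= -cardU -sum_nat_const.
apply: eq_bigr => b _; rewrite sum1dep_card -(degU b) -cards_draws.
apply: eq_card => S; rewrite !inE andbC; congr (_ && _).
by apply/forall_inP/subsetP => h a aS; have := h a aS; rewrite inE.
Qed.

Lemma card_nonneighborsT a : #|[set b | ~~ r a b]| = N - 2.
Proof.
have -> : [set b | ~~ r a b] = ~: [set b | r a b] by apply/setP => b; rewrite !inE.
by rewrite cardsCs setCK degT cardU; lia.
Qed.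

Lemma card_nonneighborsU b : #|[set a | ~~ r a b]| = N - 2.
Proof.
have -> : [set a | ~~ r a b] = ~: [set a | r a b] by apply/setP => a; rewrite !inE.
by rewrite cardsCs setCK degU cardT; lia.
Qed.

Lemma exists_rich_triple_large :
  10 < N -> exists2 S : {set T}, #|S| = 3 & 4 < #|common S|.
Proof.
move=> N10; have [/existsP[S /andP[/eqP]]|] :=
  boolP [exists S : {set T}, (#|S| == 3) && (4 < #|common S|)]; first by exists S.
rewrite negb_exists => /forallP poor; exfalso.
have : 2 * N * 'C(N + 2, 3) <= 4 * 'C(2 * N, 3).
  rewrite -sum_common -cardT -card_draws mulnC -sum_nat_const.
  under [leqRHS]eq_bigl do rewrite inE.
  apply: leq_sum => S S3.
  by have := poor S; rewrite S3 /= -leqNgt.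
have binf m : 'C(m.+3, 3) * 6 = m.+3 * (m.+2 * m.+1).
  by rewrite -[6]/(3`!) bin_ffact /falling_factorial /ffact_rec /= !muln1.
(* After multiplication by 6 and division by 2N, the left side minus the right side is M^3 + 20 M^2
   + 103 M + 36, which is positive. *)
have [M NM] : exists M, N = M + 11 by exists (N - 11); lia.
rewrite -(leq_pmul2r (isT : 0 < 6)) -!mulnA.
have -> : N + 2 = (M + 10).+3 by lia.
have -> : 2 * N = (2 * M + 19).+3 by lia.
by rewrite !binf NM; nia.
Qed.

Lemma exists_notin (s : seq T) : size s < 2 * N -> exists a, a \notin s.
Proof.
move=> sN; have /card_gt0P[a] : 0 < #|~: [set x in s]|.
  by rewrite cardsCs setCK cardT subn_gt0 cardsE (leq_ltn_trans (card_size s)).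
by rewrite !inE; exists a.
Qed.

Lemma card_common3 (a1 a2 a3 : T) :
  let n a := [set b | ~~ r a b] in
  #|common [set a1; a2; a3]| + #|n a1 :|: n a2 :|: n a3| = 2 * N.
Proof.
move=> n; rewrite -cardU -(cardsC (common [set a1; a2; a3])); congr (_ + _).
apply: eq_card => b; rewrite !inE negb_forall_in -orbA; apply/or3P/exists_inP.
  by case=> h; [exists a1|exists a2|exists a3]; rewrite ?inE ?eqxx ?orbT.
move=> [a]; rewrite !inE -orbA => /or3P[] /eqP ->.
- exact: Or31.
- exact: Or32.
- exact: Or33.
Qed.

(* For N = 4 non-adjacency is 2-regular: a path a1 - b1 - a2 - b2 - a3 in it
   gives three vertices with at most 4 nonneighbours altogether. *)
Lemma exists_rich_triple_small :
  N < 5 -> exists2 S : {set T}, #|S| = 3 & N <= #|common S|.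
Proof.
have set3 a1 a2 a3 : uniq [:: a1; a2; a3] -> #|[set a1; a2; a3]| = 3.
  by move=> /card_uniqP /= <-; apply: eq_card => x; rewrite !inE orbA.
have nonT := card_nonneighborsT; have nonU := card_nonneighborsU.
move=> N5; have [|a2 _] := @exists_notin [::]; first by rewrite /=; lia.
have [N3|N4] : N = 3 \/ N = 4 by lia.
  (* Each vertex has a single nonneighbour, so any triple keeps at least 6 - 3 = 3 common
     neighbours. *)
  have [|a1 a12] := @exists_notin [:: a2]; first by rewrite /=; lia.
  have [|a3 a32] := @exists_notin [:: a1; a2]; first by rewrite /=; lia.
  exists [set a3; a1; a2]; first by apply: set3; rewrite /= a32 a12.
  have /= := card_common3 a3 a1 a2; rewrite !cardsU !nonT /=; lia.
have /eqP/cards2P[b1 [b2 [_ n2]]] : #|[set b | ~~ r a2 b]| = 2 by rewrite nonT N4.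
have nb1 : ~~ r a2 b1 by have /setP/(_ b1) := n2; rewrite !inE eqxx.
have nb2 : ~~ r a2 b2 by have /setP/(_ b2) := n2; rewrite !inE eqxx orbT.
have other b : ~~ r a2 b -> exists2 a, a != a2 & ~~ r a b.
  move=> nb; have := cardsD1 a2 [set a | ~~ r a b]; rewrite nonU N4 inE nb => /eqP.
  rewrite eqSS eq_sym => /cards1P[a /setP/(_ a)].
  by rewrite !inE eqxx => /andP[]; exists a.
have [a1 a12 r1] := other _ nb1; have [a3 a32 r3] := other _ nb2.
have cap a b : ~~ r a b -> ~~ r a2 b ->
    0 < #|[set b | ~~ r a b] :&: [set b | ~~ r a2 b]|.
  by move=> h1 h2; apply/card_gt0P; exists b; rewrite !inE h1.
have := cap _ _ r1 nb1; have [a13|a13] := eqVneq a1 a3.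
  (* The path closes up: [a1] and [a2] have the same two nonneighbours, and any third vertex adds at
     most two more. *)
  have [|a4 a4n] := @exists_notin [:: a1; a2]; first by rewrite /=; lia.
  exists [set a1; a2; a4].
    by apply: set3; move: a4n; rewrite /= !inE !negb_or a12 !(eq_sym a4) => /andP[-> ->].
  have sub : [set b | ~~ r a2 b] \subset [set b | ~~ r a1 b].
    by rewrite n2; apply/subsetP => b; rewrite !inE => /orP[] /eqP-> //; rewrite a13.
  have /= := card_common3 a1 a2 a4; rewrite (setUidPl sub) cardsU !nonT /=; lia.
exists [set a1; a2; a3]; first by apply: set3; rewrite /= !inE negb_or a12 a13 eq_sym a32.
(* The overlaps at [b1] and [b2] reduce the 6 nonneighbours, counted with multiplicity, to at most
   4. *)
have : 0 < #|([set b | ~~ r a1 b] :|: [set b | ~~ r a2 b]) :&: [set b | ~~ r a3 b]|.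
  by apply/card_gt0P; exists b2; rewrite !inE nb2 r3 orbT.
have /= := card_common3 a1 a2 a3; rewrite !cardsU !nonT /=; lia.
Qed.

End Biregular.

Lemma closed_biregular_split (T U : finType) (r : T -> U -> bool) (N : nat) :
  #|T| = 2 * N -> #|U| = 2 * N ->
  (forall a, #|[set b | r a b]| = N + 2) ->
  (forall b, #|[set a | r a b]| = N + 2) ->
  K33_closed r -> 2 < N -> 10 < N \/ N < 5 ->
  exists C : {set T}, exists D : {set U},
    [/\ #|C| = N, #|D| = N, {in C & D, forall a b, r a b}
      & {in ~: C & ~: D, forall a b, r a b}].
Proof.
move=> cardT cardU degT degU cl N2 Nrange.
have [S S3 cS] : exists2 S : {set T}, #|S| = 3 & 4 < #|common r S| \/ N <= #|common r S|.
  case: Nrange => h.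
    by have [S S3 cS] := exists_rich_triple_large N2 cardT cardU degU h; exists S; auto.
  have [S S3 cS] := exists_rich_triple_small N2 cardT cardU degT degU h.
  by exists S; auto.
pose D := common r S; pose C := [set a | [forall b in D, r a b]].
have SC : S \subset C.
  apply/subsetP=> a aS; rewrite inE; apply/forall_inP => b.
  by rewrite inE => /forall_inP/(_ _ aS).
have CD : {in C & D, forall a b, r a b}.
  by move=> a b; rewrite inE => /forall_inP; apply.
have C3 : 2 < #|C| by rewrite -S3 subset_leq_card.
have D3 : 2 < #|D| by rewrite /D; case: cS => h; lia.
have triple (V : finType) (E : {set V}) : 2 < #|E| ->
    exists x y z, [/\ uniq [:: x; y; z], x \in E, y \in E & z \in E].
  move=> /card_gt2P[x [y [z [[xE yE zE] [xy yz zx]]]]]; exists x, y, z; split=> //.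
  by rewrite /= !inE negb_or xy yz eq_sym zx.
have [a1 [a2 [a3 [ua a1C a2C a3C]]]] := triple _ _ C3.
have [b1 [b2 [b3 [ub b1D b2D b3D]]]] := triple _ _ D3.
(* Three neighbours of [a] in [D] form a K33 with [a1], [a2], [a3]. By closedness [a] is adjacent to
   every common neighbour of these three, hence to all of [D], and so lies in [C]. *)
have outC a : a \notin C -> #|D :&: [set b | r a b]| <= 2.
  apply: contraNT; rewrite -ltnNge => /triple[y1 [y2 [y3 [uy]]]].
  rewrite !in_setI => /andP[y1D ay1] /andP[y2D ay2] /andP[y3D ay3].
  rewrite inE; apply/forall_inP => b bD.
  move: ay1 ay2 ay3; rewrite !inE => ay1 ay2 ay3.
  apply: (cl a1 a2 a3 y1 y2 y3) => //=; rewrite ?ay1 ?ay2 ?ay3 //.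
    by rewrite /allrel /= !CD.
  by rewrite !CD.
(* Membership in [D] means adjacency to [S], whose elements lie in [C] and are therefore adjacent to
   [b1], [b2], [b3]. *)
have outD b : b \notin D -> #|C :&: [set a | r a b]| <= 2.
  apply: contraNT; rewrite -ltnNge => /triple[y1 [y2 [y3 [uy]]]].
  rewrite !in_setI => /andP[y1C ay1] /andP[y2C ay2] /andP[y3C ay3].
  rewrite inE; apply/forall_inP => a /(subsetP SC) aC.
  move: ay1 ay2 ay3; rewrite !inE => ay1 ay2 ay3.
  apply: (cl y1 y2 y3 b1 b2 b3) => //=; rewrite ?ay1 ?ay2 ?ay3 //.
    by rewrite /allrel /= !CD.
  by rewrite !CD.
have [DN h1 compl] := closed_biclique_bounds N2 cardT cardU degT degU
  (leq_trans (isT : 0 < 3) D3) CD outC.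
have DC : {in D & C, forall b a, r a b} by move=> b a bD aC; apply: CD.
have [CN h2 _] := closed_biclique_bounds N2 cardU cardT degU degT
  (leq_trans (isT : 0 < 3) C3) DC outD.
rewrite (mulnC #|D| #|C|) in h2.
have [cC cD] := biclique_arith N2 CN DN cS h1 h2.
by exists C, D; split=> //; apply: compl.
Qed.

Local Open Scope ring_scope.

(** The terms at (i, j) and (j, i) cancel. The diagonal is a separate hypothesis because
    antisymmetry does not kill it in characteristic two. *)
Lemma sum_alternating (V : zmodType) n (f : 'I_n -> 'I_n -> V) :
  (forall i, f i i = 0) -> (forall i j, f i j = - f j i) -> \sum_i \sum_j f i j = 0.
Proof.
move=> f0 fN.
have -> : \sum_i \sum_j f i j =
    \sum_(i < n) \sum_(j < n | (j < i)%N) f i j +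
    \sum_(i < n) \sum_(j < n | (i < j)%N) f i j.
  rewrite -big_split; apply: eq_bigr => i _ /=.
  rewrite (bigID (fun j : 'I_n => (j < i)%N)) /=; congr (_ + _).
  rewrite (bigD1 i) ?ltnn //= f0 add0r; apply: eq_bigl => j.
  by rewrite -leqNgt -val_eqE /= (ltn_neqAle i) eq_sym andbC.
rewrite [X in _ + X](exchange_big_dep predT) //= -big_split big1 // => i _ /=.
rewrite -big_split big1 //= => j _.
by rewrite [f j i]fN subrr.
Qed.

(** * Lines in projective space and their transversals *)

Section Lines.

Variable k : fieldType.
Implicit Types (l m n a b x y : line k) (u v w e f g h : 'rV[k]_4).

Lemma dim_line l : \dim (val l) = 2%N.
Proof. exact: eqP (valP l). Qed.

Lemma meetsP l m : reflect (exists v, [/\ v != 0, v \in val l & v \in val m]) (meets l m).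
Proof.
rewrite /meets -vpick0; apply: (iffP idP) => [nz|[v [nz vl vm]]].
  exists (vpick (val l :&: val m)%VS); split=> //.
    exact: (subvP (capvSl _ _)) _ (memv_pick _).
  exact: (subvP (capvSr _ _)) _ (memv_pick _).
rewrite vpick0; apply: contraNneq nz => lm0.
by rewrite -memv0 -lm0 memv_cap vl.
Qed.

Lemma meetsC l m : meets l m = meets m l.
Proof. by rewrite /meets capvC. Qed.

Lemma meets_refl l : meets l l.
Proof. by rewrite /meets capvv -dimv_eq0 (dim_line l). Qed.

Lemma skew_eq0 l m v : skew l m -> v \in val l -> v \in val m -> v = 0.
Proof.
move=> sk vl vm; apply/eqP; apply: contraNT sk => nz.
by apply/meetsP; exists v.
Qed.

Definition indep2 u v := forall s t, s *: u + t *: v = 0 -> s = 0 /\ t = 0.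

Lemma indep2_skew l m u v :
  skew l m -> u \in val l -> v \in val m -> u != 0 -> v != 0 -> indep2 u v.
Proof.
move=> sk ul vm u0 v0 s t /eqP; rewrite addr_eq0 => /eqP E.
have su0 : s *: u = 0.
  by apply: (skew_eq0 sk); last rewrite E memvN; exact: memvZ.
move: su0 (E) => /eqP; rewrite scaler_eq0 (negPf u0) orbF => /eqP ->.
rewrite scale0r => /esym/eqP; rewrite oppr_eq0 scaler_eq0 (negPf v0) orbF => /eqP.
by [].
Qed.

Lemma line_span l u v w : indep2 u v -> u \in val l -> v \in val l ->
  w \in val l -> exists s t, w = s *: u + t *: v.
Proof.
move=> ind ul vl wl.
have fr : free [:: u; v].
  apply/freeP => c; rewrite !big_ord_recl big_ord0 /= addr0 => /ind[c0 c1] i.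
  by case: (unliftP ord0 i) => [j|] -> //; rewrite ord1.
have /eqP/esym E : (<<[:: u; v]>> == val l)%VS.
  rewrite eqEdim dim_line (eqnP fr) andbT; apply/span_subvP => z.
  by rewrite !inE => /orP[] /eqP ->.
move: wl; rewrite E span_cons span_seq1 => /memv_addP[_ /vlineP[s ->]].
by move=> [_ /vlineP[t ->] ->]; exists s, t.
Qed.

Lemma line_eq l m u v : indep2 u v -> u \in val l -> v \in val l ->
  u \in val m -> v \in val m -> l = m.
Proof.
move=> ind ul vl um vm; apply/val_inj/eqP.
rewrite eqEdim dim_line dim_line andbT; apply/subvP => w wl.
by have [s [t ->]] := line_span ind ul vl wl; rewrite memvD // memvZ.
Qed.

Definition indep4 e f g h := forall s t s' t',
  s *: e + t *: f + s' *: g + t' *: h = 0 -> [/\ s = 0, t = 0, s' = 0 & t' = 0].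

Lemma indep4_span e f g h w : indep4 e f g h ->
  exists s t s' t', w = s *: e + t *: f + s' *: g + t' *: h.
Proof.
move=> ind.
have fr : free [:: e; f; g; h].
  apply/freeP => c; rewrite !big_ord_recl big_ord0 /= addr0 !addrA.
  move=> /ind[c0 c1 c2 c3] i.
  by do 3!(case: (unliftP ord0 i) => [{}i|] -> //); rewrite ord1.
have /eqP E : (<<[:: e; f; g; h]>> == fullv)%VS.
  by rewrite eqEdim subvf (eqnP fr) dimvf /dim /=.
have : w \in fullv by rewrite memvf.
rewrite -E !span_cons span_nil addv0.
move=> /memv_addP[_ /vlineP[s ->] [z /memv_addP[_ /vlineP[t ->] Ez] ->]].
move: Ez => [_ /memv_addP[_ /vlineP[s' ->] [_ /vlineP[t' ->] ->]] ->].
by exists s, t, s', t'; rewrite !addrA.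
Qed.

(* In k^4 = k^2 (x) k^2 with e, f, g, h the products u_1 (x) u_1, u_1 (x) u_2,
   u_2 (x) u_1, u_2 (x) u_2 of basis vectors and u_3 = u_1 + u_2, the line a_i is
   u_i (x) k^2 and b_j is k^2 (x) u_j. *)
Definition grid a1 a2 a3 b1 b2 b3 e f g h : Prop :=
  [/\ indep4 e f g h,
      [/\ e \in val a1, f \in val a1, g \in val a2 & h \in val a2],
      e + g \in val a3 /\ f + h \in val a3,
      [/\ e \in val b1, g \in val b1, f \in val b2 & h \in val b2]
    & e + f \in val b3 /\ g + h \in val b3].

(** If a coefficient vanished, [w] would lie on [l] or on [m], both skew to [n]. *)
Lemma skew3_comb l m n (c : line k) u v w :
  skew l m -> skew l n -> skew m n -> u \in val l -> v \in val m -> w \in val n ->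
  u \in val c -> v \in val c -> w \in val c -> u != 0 -> v != 0 -> w != 0 ->
  exists s t, [/\ s != 0, t != 0 & w = s *: u + t *: v].
Proof.
move=> lm ln mn ul vm wn uc vc wc u0 v0 w0.
have [s [t E]] := line_span (indep2_skew lm ul vm u0 v0) uc vc wc.
exists s, t; split=> //; apply: contraNneq w0 => z; apply/eqP.
  by apply: (skew_eq0 mn) => //; rewrite E z scale0r add0r memvZ.
by apply: (skew_eq0 ln) => //; rewrite E z scale0r addr0 memvZ.
Qed.

Lemma indep4_skew l m e f g h : skew l m -> indep2 e f -> indep2 g h ->
  e \in val l -> f \in val l -> g \in val m -> h \in val m -> indep4 e f g h.
Proof.
move=> lm ef gh el fl gm hm s t s' t'; rewrite -addrA => E.
have z : s *: e + t *: f = 0.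
  apply: (skew_eq0 lm); first by rewrite memvD // memvZ.
  move/eqP: E; rewrite addr_eq0 => /eqP ->.
  by rewrite memvN memvD // memvZ.
by move: E; rewrite z add0r => /gh[-> ->]; have [-> ->] := ef _ _ z.
Qed.

(** The four points where [a1], [a2] meet [b1], [b2] form a basis; the remaining intersection points
    dictate how to rescale it. *)
Lemma grid_exists a1 a2 a3 b1 b2 b3 :
  skew a1 a2 -> skew a1 a3 -> skew a2 a3 ->
  skew b1 b2 -> skew b1 b3 -> skew b2 b3 ->
  allrel (@meets k) [:: a1; a2; a3] [:: b1; b2; b3] ->
  exists e f g h, grid a1 a2 a3 b1 b2 b3 e f g h.
Proof.
move=> a12 a13 a23 b12 b13 b23; rewrite /allrel /= !andbT.
case/and3P=> /and3P[m11 m12 m13] /and3P[m21 m22 m23] /and3P[m31 m32 m33].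
have [e [e0 ea eb]] := meetsP _ _ m11; have [f [f0 fa fb]] := meetsP _ _ m12.
have [g [g0 ga gb]] := meetsP _ _ m21; have [h [h0 ha hb]] := meetsP _ _ m22.
have [p [p0 pa pb]] := meetsP _ _ m31; have [q [q0 qa qb]] := meetsP _ _ m32.
have [u [u0 ua ub]] := meetsP _ _ m13; have [v [v0 va vb]] := meetsP _ _ m23.
have [w [w0 wa wb]] := meetsP _ _ m33.
have [s1 [t1 [s1n t1n Ep]]] := skew3_comb a12 a13 a23 ea ga pa eb gb pb e0 g0 p0.
have [s2 [t2 [s2n t2n Eq]]] := skew3_comb a12 a13 a23 fa ha qa fb hb qb f0 h0 q0.
have [s3 [t3 [s3n t3n Ew]]] := skew3_comb b12 b13 b23 pb qb wb pa qa wa p0 q0 w0.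
have [s4 [t4 [s4n t4n Eu]]] := skew3_comb b12 b13 b23 eb fb ub ea fa ua e0 f0 u0.
have [s5 [t5 [s5n t5n Ev]]] := skew3_comb b12 b13 b23 gb hb vb ga ha va g0 h0 v0.
have [s6 [t6 [s6n t6n Ew']]] := skew3_comb a12 a13 a23 ua va wa ub vb wb u0 v0 w0.
have ind : indep4 e f g h.
  by apply: (indep4_skew a12) => //; apply: (indep2_skew b12).
(* The point [w] of [a3] and [b3] is expanded in two ways, along [a3] through [p], [q] and along
   [b3] through [u], [v]. *)
have [|z1 z2 z3 z4] := ind (s3 * s1 - s6 * s4) (t3 * s2 - s6 * t4)
    (s3 * t1 - t6 * s5) (t3 * t2 - t6 * t5).
  have /eqP : s3 *: (s1 *: e + t1 *: g) + t3 *: (s2 *: f + t2 *: h) =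
      s6 *: (s4 *: e + t4 *: f) + t6 *: (s5 *: g + t5 *: h).
    by rewrite -Ep -Eq -Eu -Ev -Ew -Ew'.
  by rewrite -subr_eq0 => /eqP <-; apply/rowP => i; rewrite !mxE; ring.
(* With these scalings the four sums required by [grid] are s3 p, t3 q, s6 u and t6 v. *)
exists ((s3 * s1) *: e), ((t3 * s2) *: f), ((s3 * t1) *: g), ((t3 * t2) *: h).
split.
- move=> c1 c2 c3 c4; rewrite !scalerA => /ind[] /eqP + /eqP + /eqP + /eqP.
  rewrite !mulf_eq0 (negPf s1n) (negPf s2n) (negPf s3n) (negPf t1n) (negPf t2n).
  by rewrite (negPf t3n) !orbF => /eqP-> /eqP-> /eqP-> /eqP->.
- by split; apply: memvZ.
- by split; rewrite -!scalerA -scalerDr -?Ep -?Eq; apply: memvZ.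
- by split; apply: memvZ.
- rewrite (subr0_eq z1) (subr0_eq z2) (subr0_eq z3) (subr0_eq z4).
  by split; rewrite -!scalerA -scalerDr -?Eu -?Ev; apply: memvZ.
Qed.

(** Swapping the two tensor factors exchanges [f] and [g]. *)
Lemma grid_transpose a1 a2 a3 b1 b2 b3 e f g h :
  grid a1 a2 a3 b1 b2 b3 e f g h -> grid b1 b2 b3 a1 a2 a3 e g f h.
Proof.
move=> [ind [? ? ? ?] [? ?] [? ? ? ?] [? ?]]; split=> // s t s' t'.
by rewrite (addrAC (s *: e)) => /ind[].
Qed.

(** In tensor coordinates the transversal is (s u_1 + t u_2) (x) k^2. Its point on [b3], with
    coordinates [s], [t], is a combination of its points on [b1] and [b2]; comparing coefficients
    shows that both of these are proportional to (s, t). *)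
Lemma grid_transversal a1 a2 a3 b1 b2 b3 e f g h x :
  grid a1 a2 a3 b1 b2 b3 e f g h -> all (meets x) [:: b1; b2; b3] ->
  exists s t, [/\ (s != 0) || (t != 0), s *: e + t *: g \in val x
                & s *: f + t *: h \in val x].
Proof.
move=> [ind _ _ [eb1 gb1 fb2 hb2] [efb3 ghb3]] /= /and4P[xb1 xb2 xb3 _].
have [v1 [v1n0 v1x v1b]] := meetsP _ _ xb1.
have [v2 [v2n0 v2x v2b]] := meetsP _ _ xb2.
have [v3 [v3n0 v3x v3b]] := meetsP _ _ xb3.
have i1 : indep2 e g.
  by move=> s t st0; have [|-> _ -> _] // := ind s 0 t 0; rewrite !scale0r !addr0.
have i2 : indep2 f h.
  by move=> s t st0; have [|_ -> _ ->] // := ind 0 s 0 t; rewrite !scale0r add0r addr0.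
have i3 : indep2 (e + f) (g + h).
  by move=> s t; rewrite !scalerDr addrA => /ind[-> _ -> _].
have [s1 [t1 E1]] := line_span i1 eb1 gb1 v1b.
have [s2 [t2 E2]] := line_span i2 fb2 hb2 v2b.
have [s3 [t3 E3]] := line_span i3 efb3 ghb3 v3b.
have i12 : indep2 v1 v2.
  move=> c c'; rewrite E1 E2 !scalerDr !scalerA => E.
  have [|z1 z2 z3 z4] := ind (c * s1) (c' * s2) (c * t1) (c' * t2).
    by rewrite -E !addrA (addrAC (_ *: e)).
  split; apply/eqP.
    apply: contraNT v1n0 => c0; rewrite E1.
    move/eqP: z1; move/eqP: z3; rewrite !mulf_eq0 (negPf c0) /= => /eqP-> /eqP->.
    by rewrite !scale0r addr0.
  apply: contraNT v2n0 => c0; rewrite E2.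
  move/eqP: z2; move/eqP: z4; rewrite !mulf_eq0 (negPf c0) /= => /eqP-> /eqP->.
  by rewrite !scale0r addr0.
have [c [c' Ec]] := line_span i12 v1x v2x v3x.
have [|z1 z2 z3 z4] := ind (s3 - c * s1) (s3 - c' * s2) (t3 - c * t1) (t3 - c' * t2).
  have /eqP : s3 *: (e + f) + t3 *: (g + h) =
      c *: (s1 *: e + t1 *: g) + c' *: (s2 *: f + t2 *: h).
    by rewrite -E1 -E2 -Ec.
  by rewrite -subr_eq0 => /eqP <-; apply/rowP => i; rewrite !mxE; ring.
exists s3, t3; split.
- apply: contraNT v3n0; rewrite negb_or !negbK E3 => /andP[/eqP-> /eqP->].
  by rewrite !scale0r addr0.
- rewrite (subr0_eq z1) (subr0_eq z3) -!scalerA -scalerDr -E1; exact: memvZ.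
- rewrite (subr0_eq z2) (subr0_eq z4) -!scalerA -scalerDr -E2; exact: memvZ.
Qed.

(** The two transversals are u (x) k^2 and k^2 (x) u' with u = (s, t) and u' = (s', t'); they share
    the nonzero pure tensor u (x) u'. *)
Lemma meets_closed a1 a2 a3 b1 b2 b3 x y :
  skew a1 a2 -> skew a1 a3 -> skew a2 a3 ->
  skew b1 b2 -> skew b1 b3 -> skew b2 b3 ->
  allrel (@meets k) [:: a1; a2; a3] [:: b1; b2; b3] ->
  all (meets x) [:: b1; b2; b3] -> all ((@meets k)^~ y) [:: a1; a2; a3] -> meets x y.
Proof.
move=> a12 a13 a23 b12 b13 b23 ab xb ay.
have [e [f [g [h G]]]] := grid_exists a12 a13 a23 b12 b13 b23 ab.
have [s [t [st0 egx fhx]]] := grid_transversal G xb.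
have ya : all (meets y) [:: a1; a2; a3].
  by move: ay; rewrite /= !(meetsC y).
have [s' [t' [st'0 efy ghy]]] := grid_transversal (grid_transpose G) ya.
have [ind _ _ _ _] := G; apply/meetsP.
exists (s' *: (s *: e + t *: g) + t' *: (s *: f + t *: h)); split; last 2 first.
- by rewrite memvD // memvZ.
- have -> : s' *: (s *: e + t *: g) + t' *: (s *: f + t *: h) =
     s *: (s' *: e + t' *: f) + t *: (s' *: g + t' *: h).
    by apply/rowP => i; rewrite !mxE; ring.
  by rewrite memvD // memvZ.
apply/eqP => w0; have [|z1 z2 z3 z4] := ind (s * s') (s * t') (t * s') (t * t').
  by rewrite -w0; apply/rowP => i; rewrite !mxE; ring.
move/eqP: z1; move/eqP: z2; move/eqP: z3; move/eqP: z4; rewrite !mulf_eq0.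
case/orP: st0 => /negPf->; case/orP: st'0 => /negPf->; rewrite ?orbF //=.
Qed.

(** * Quadrics through three skew lines *)

Definition bilin (M : 'M[k]_4) u v : k := (u *m M *m v^T) 0 0.

(** Up to a scalar the quadric is the determinant, that is, the Segre quadric of pure tensors.
    Vanishing at [e], [f], [g], [h] and at e + f, g + h, e + g, f + h kills eight of the ten
    coefficients; vanishing at (e + g) + (f + h) makes the other two opposite. *)
Lemma quadric_on_grid a1 a2 a3 b1 b2 b3 e f g h (M : 'M[k]_4) :
  grid a1 a2 a3 b1 b2 b3 e f g h ->
  (forall v, [|| v \in val a1, v \in val a2 | v \in val a3] -> bilin M v v = 0) ->
  exists c, forall s t s' t',
    let v := s *: e + t *: f + s' *: g + t' *: h in
    bilin M v v = (s * t' - t * s') * c.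
Proof.
move=> [ind [ea fa ga ha] [eg fh] _ _] van.
have bD1 u v w : bilin M (u + v) w = bilin M u w + bilin M v w.
  by rewrite /bilin !mulmxDl mxE.
have bD2 u v w : bilin M u (v + w) = bilin M u v + bilin M u w.
  by rewrite /bilin linearD /= mulmxDr mxE.
have bZ1 c u v : bilin M (c *: u) v = c * bilin M u v.
  by rewrite /bilin -!scalemxAl mxE.
have bZ2 c u v : bilin M u (c *: v) = c * bilin M u v.
  by rewrite /bilin linearZ /= -scalemxAr mxE.
have van1 v : v \in val a1 -> bilin M v v = 0 by move=> h1; apply: van; rewrite h1.
have van2 v : v \in val a2 -> bilin M v v = 0 by move=> h1; apply: van; rewrite h1 orbT.
have van3 v : v \in val a3 -> bilin M v v = 0 by move=> h1; apply: van; rewrite h1 !orbT.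
have ee := van1 _ ea; have ff := van1 _ fa; have ef := van1 _ (memvD ea fa).
have gg := van2 _ ga; have hh := van2 _ ha; have gh := van2 _ (memvD ga ha).
have egeg := van3 _ eg; have fhfh := van3 _ fh; have egfh := van3 _ (memvD eg fh).
rewrite !(bD1, bD2) in ef gh egeg fhfh egfh.
exists (bilin M e h + bilin M h e) => s t s' t' /=.
rewrite !(bD1, bD2, bZ1, bZ2).
have neg (x y z w : k) : x = 0 -> w = 0 -> x + y + (z + w) = 0 -> z = - y.
  by move=> -> ->; rewrite addr0 add0r addrC => /eqP; rewrite addr_eq0 => /eqP.
have fe := neg _ _ _ _ ee ff ef; have hg := neg _ _ _ _ gg hh gh.
have ge := neg _ _ _ _ ee gg egeg; have hf := neg _ _ _ _ ff hh fhfh.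
rewrite ee ff gg hh fe hg ge hf in egfh *.
have -> : bilin M g f = - (bilin M e h + bilin M h e + bilin M f g).
  apply/eqP; rewrite -addr_eq0 -{}[X in _ == X]egfh.
  by apply/eqP; ring.
by ring.
Qed.

(** Arbitrary matrices are used because in characteristic two the symmetric ones do not give all
    quadratic forms. *)
Definition quad_mpoly (M : 'M[k]_4) : {mpoly k[4]} :=
  \sum_i \sum_j M i j *: ('X_i * 'X_j).

Lemma quad_mpolyD (M M' : 'M[k]_4) : quad_mpoly (M + M') = quad_mpoly M + quad_mpoly M'.
Proof.
rewrite -big_split; apply: eq_bigr => i _; rewrite -big_split; apply: eq_bigr => j _ /=.
by rewrite mxE scalerDl.
Qed.

Lemma quad_mpolyZ c (M : 'M[k]_4) : quad_mpoly (c *: M) = c *: quad_mpoly M.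
Proof.
rewrite scaler_sumr; apply: eq_bigr => i _; rewrite scaler_sumr; apply: eq_bigr => j _.
by rewrite mxE scalerA.
Qed.

Lemma homog2_quad_mpoly (Q : {mpoly k[4]}) : Q \is 2.-homog -> exists M, Q = quad_mpoly M.
Proof.
move=> /dhomogP homQ; rewrite [Q]mpolyE big_seq.
apply: (big_ind (fun P => exists M, P = quad_mpoly M)).
- exists 0; rewrite /quad_mpoly big1 // => i _; rewrite big1 // => j _.
  by rewrite mxE scale0r.
- by move=> _ _ [M ->] [M' ->]; exists (M + M'); rewrite quad_mpolyD.
move=> m /homQ /= m2.
have [i mi] : exists i, (0 < m i)%N.
  apply/existsP; apply: contraTT (isT : (0 < 2)%N); rewrite negb_exists => /forallP m0.
  rewrite -m2 mdegE big1 // => i _.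
  by have := m0 i; rewrite -eqn0Ngt => /eqP.
have Um : (U_(i) <= m)%MM by rewrite lep1mP -lt0n.
have /mdeg1P[j /eqP mj] : mdeg (m - U_(i))%MM == 1%N.
  by rewrite -(eqn_add2r (mdeg U_(i)%MM)) -mdegD submK // m2 mdeg1.
exists (Q@_m *: delta_mx i j); rewrite quad_mpolyZ; congr (_ *: _).
rewrite -(submK Um) mj mpolyXD mulrC /quad_mpoly (bigD1 i) //= (bigD1 j) //=.
rewrite mxE !eqxx scale1r !big1 ?addr0 //.
  move=> i' /negPf ni; rewrite big1 // => j' _.
  by rewrite mxE ni scale0r.
by move=> j' /negPf nj; rewrite mxE nj andbF scale0r.
Qed.

Lemma meval_quad_mpoly (M : 'M[k]_4) v : (quad_mpoly M).@[v 0] = bilin M v v.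
Proof.
rewrite /quad_mpoly /bilin mxE raddf_sum /=.
under eq_bigr => i _ do rewrite raddf_sum /=.
rewrite exchange_big; apply: eq_bigr => j _ /=; rewrite !mxE mulr_suml.
by apply: eq_bigr => i _; rewrite mevalZ mevalM !mevalXU; ring.
Qed.

(** Evaluation at the basis vectors and at their pairwise sums shows that [M] is alternating. *)
Lemma quad_mpoly_eq0 (M : 'M[k]_4) : (forall v, bilin M v v = 0) -> quad_mpoly M = 0.
Proof.
move=> van.
have diag i : M i i = 0.
  by have := van (delta_mx 0 i); rewrite /bilin trmx_delta -rowE -colE !mxE.
have skw i j : M i j = - M j i.
  have := van (delta_mx 0 i + delta_mx 0 j).
  rewrite /bilin linearD /= !trmx_delta !mulmxDl !mulmxDr -!rowE -!colE !mxE !diag.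
  by rewrite add0r addr0 => /eqP; rewrite addr_eq0 => /eqP.
by apply: sum_alternating => [i|i j]; rewrite ?diag ?scale0r // skw scaleNr mulrC.
Qed.

(** In grid coordinates both quadrics are nonzero multiples, by [c] and [c'], of the same
    determinant; the lines b_j serve to build the grid. *)
Lemma quadric_unique a1 a2 a3 b1 b2 b3 (Q R : {mpoly k[4]}) :
  skew a1 a2 -> skew a1 a3 -> skew a2 a3 ->
  skew b1 b2 -> skew b1 b3 -> skew b2 b3 ->
  allrel (@meets k) [:: a1; a2; a3] [:: b1; b2; b3] ->
  Q \is 2.-homog -> R \is 2.-homog -> Q != 0 -> R != 0 ->
  [/\ line_on Q a1, line_on Q a2 & line_on Q a3] ->
  [/\ line_on R a1, line_on R a2 & line_on R a3] ->
  same_surface Q R.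
Proof.
move=> a12 a13 a23 b12 b13 b23 ab /homog2_quad_mpoly[M ->] /homog2_quad_mpoly[M' ->].
move=> M0 M'0 [Q1 Q2 Q3] [R1 R2 R3].
have [e [f [g [h G]]]] := grid_exists a12 a13 a23 b12 b13 b23 ab.
have vanish v : [|| v \in val a1, v \in val a2 | v \in val a3] ->
    bilin M v v = 0 /\ bilin M' v v = 0.
  rewrite -!meval_quad_mpoly => /or3P[] vl.
  - by split; [apply: Q1|apply: R1].
  - by split; [apply: Q2|apply: R2].
  - by split; [apply: Q3|apply: R3].
have [c Ec] := quadric_on_grid G (fun v vl => (vanish v vl).1).
have [c' Ec'] := quadric_on_grid G (fun v vl => (vanish v vl).2).
have span w := indep4_span w (let: And5 ind _ _ _ _ := G in ind).
have c0 : c != 0.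
  apply: contraNneq M0 => z; rewrite quad_mpoly_eq0 // => v.
  by have [s [t [s' [t' ->]]]] := span v; rewrite Ec z mulr0.
have c'0 : c' != 0.
  apply: contraNneq M'0 => z; rewrite quad_mpoly_eq0 // => v.
  by have [s [t [s' [t' ->]]]] := span v; rewrite Ec' z mulr0.
exists (c' / c); first by rewrite mulf_neq0 ?invr_eq0.
apply/eqP; rewrite -subr_eq0 -scaleNr -!quad_mpolyZ -quad_mpolyD quad_mpoly_eq0 // => v.
have -> : bilin (M' + (- (c' / c)) *: M) v v = bilin M' v v - c' / c * bilin M v v.
  rewrite /bilin mulmxDr mulmxDl mxE -scalemxAr -scalemxAl; congr (_ + _).
  by rewrite mxE mulNr.
have [s [t [s' [t' ->]]]] := span v; rewrite Ec Ec'.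
by field.
Qed.

End Lines.

(** * Lines over an algebraically closed field *)

Lemma closed_field_notin (k : closedFieldType) (s : seq k) : exists t, t \notin s.
Proof.
have /closed_nonrootP[t] : \prod_(z <- s) ('X - z%:P) != 0.
  exact: monic_neq0 (monic_prod_XsubC _ _ _).
by rewrite root_prod_XsubC; exists t.
Qed.

(** Among the points u + t v of [l], with [t] in an infinite field, each line other than [l]
    contains at most one. *)
Lemma line_cover (k : closedFieldType) (l : line k) (s : seq (line k)) :
  (forall v, v != 0 -> v \in val l -> exists2 m, m \in s & v \in val m) -> l \in s.
Proof.
move=> cov; apply/negPn/negP => ls.
have [u [v [ind ul vl]]] : exists u v, [/\ indep2 u v, u \in val l & v \in val l].
  have [X fX lX] : exists2 X : 2.-tuple 'rV[k]_4, free X & (<<X>> = val l)%VS.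
    have /andP[/eqP sp fr] := vbasisP (val l); rewrite -sp.
    by move: (vbasis _) fr {sp}; rewrite dim_line => X fX; exists X.
  exists X`_0, X`_1; split; try by rewrite -lX memv_span // mem_nth // size_tuple.
  move=> s0 t0 E.
  have /freeP/(_ (fun i => if i == ord0 then s0 else t0)) := fX.
  rewrite !big_ord_recl big_ord0 /= addr0 => /(_ E) z.
  by have := z ord0; have := z ord_max.
have [bad badP] : exists bad : seq k, forall t,
    (exists2 m, m \in s & u + t *: v \in val m) -> t \in bad.
  elim: s ls {cov} => [|m s IH]; first by exists [::] => t [].
  rewrite inE negb_or => /andP[lm /IH[bad badP]].
  (* If [m] contains [v], it contains no u + t v, since otherwise it would equal [l]. If not, only t
     = -c is possible, where u = w + c v with [w] in [m]. *)
  have [vm|vm] := boolP (v \in val m).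
    exists bad => t [n]; rewrite inE => /orP[/eqP->|ns un]; last by apply: badP; exists n.
    move=> um; have um' : u \in val m.
      by rewrite -(addrK (t *: v) u) memvB // memvZ.
    by rewrite (line_eq ind ul vl um' vm) eqxx in lm.
  have [/memv_addP[w wm [_ /vlineP[c ->] Eu]]|nuv] := boolP (u \in val m + <[v]>)%VS.
    exists (- c :: bad) => t [n]; rewrite inE => /orP[/eqP->|ns un]; last first.
      by rewrite inE badP ?orbT //; exists n.
    rewrite Eu -addrA -scalerDl => h.
    have : (c + t) *: v \in val m by rewrite -(addKr w (_ *: v)) memvD // memvN.
    rewrite inE; have [/eqP|nz] := eqVneq (c + t) 0.
      by rewrite addrC addr_eq0 => ->.
    by move=> /(memvZ (c + t)^-1); rewrite scalerA mulVf // scale1r (negPf vm).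
  exists bad => t [n]; rewrite inE => /orP[/eqP->|ns un]; last by apply: badP; exists n.
  move=> h; case/negP: nuv; rewrite -(addrK (t *: v) u) -scaleNr.
  by rewrite memv_add // memvZ // memv_line.
have [t tbad] := closed_field_notin bad.
have nz : u + t *: v != 0.
  by apply/eqP => z; have [] := ind 1 t; rewrite ?scale1r // => /eqP; rewrite oner_eq0.
have [|m ms um] := cov _ nz; first by rewrite memvD // memvZ.
by case/negP: tbad; apply: badP; exists m.
Qed.

Local Open Scope fset_scope.

(** * Passage between finite sets of lines and finite types *)

Lemma card_fset_val (K : choiceType) (B : {fset K}) (X : {set B}) :
  #|` [fset val x | x in X]| = #|X|.
Proof.
rewrite card_imfset; last exact: val_inj.
rewrite cardE; apply/perm_size/uniq_perm; rewrite ?enum_uniq ?enum_finmem_uniq //.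
Qed.

Lemma card_fset_sep (K : choiceType) (B : {fset K}) (P : pred K) :
  #|` [fset x in B | P x]| = #|[set x : B | P (val x)]|.
Proof.
have -> : [fset x in B | P x] = [fset val x | x in [set x : B | P (val x)]].
  apply/fsetP => x; rewrite !inE; apply/andP/imfsetP => /= [[xB Px]|[y]].
    by exists [` xB]; rewrite ?inE.
  by rewrite inE => Py ->; split=> //; apply: valP.
exact: card_fset_val.
Qed.

Lemma fset_triple (K : choiceType) (S : {fset K}) : (2 < #|` S|)%N ->
  exists x y z, [/\ x != y, x != z & y != z] /\ [/\ x \in S, y \in S & z \in S].
Proof.
rewrite cardfE => /card_gt2P[x [y [z [_ [xy yz zx]]]]].
exists (val x), (val y), (val z); split; last by split; apply: valP.
by rewrite !(inj_eq val_inj) xy yz eq_sym zx.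
Qed.

(** * Splitting a double 2d into quadric configurations *)

Section DoubleConfigurations.

Variables (k : fieldType) (d : nat).
Implicit Types (A B C M N : {fset line k}) (l m : line k).

Lemma pairwise_skew_sub A M : M `<=` A -> pairwise_skew A -> pairwise_skew M.
Proof. by move=> /fsubsetP MA skA l m /MA lA /MA mA; apply: skA. Qed.

Lemma double_2d_disjoint A B : double_2d d A B -> [disjoint A & B].
Proof.
move=> [[_ cB] [_ skB] degA _]; apply/fdisjointP => l lA; apply/negP => lB.
have := degA _ lA; have -> : [fset m in B | meets l m] = [fset l].
  apply/fsetP => m; rewrite !inE; apply/andP/eqP => [[mB]|->].
    by apply: contraTeq => ml; apply: skB => //; rewrite eq_sym.
  by rewrite lB meets_refl.
by rewrite cardfs1; lia.
Qed.

Lemma meets_K33_closed A B : pairwise_skew A -> pairwise_skew B ->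
  K33_closed (fun (a : A) (b : B) => meets (val a) (val b)).
Proof.
move=> skA skB a1 a2 a3 b1 b2 b3 x y ua ub ab xb ay.
have sk (S : {fset line k}) (z1 z2 z3 : S) : pairwise_skew S -> uniq [:: z1; z2; z3] ->
    [/\ skew (val z1) (val z2), skew (val z1) (val z3) & skew (val z2) (val z3)].
  move=> skS; rewrite /= !inE negb_or andbT => /andP[/andP[z12 z13] z23].
  have ne (z z' : S) : z != z' -> skew (val z) (val z').
    by move=> zz'; apply: (skS _ _ (valP z) (valP z')); apply: contraNneq zz' => /val_inj ->.
  by split; apply: ne.
have [a12 a13 a23] := sk _ _ _ _ skA ua; have [b12 b13 b23] := sk _ _ _ _ skB ub.
exact: (@meets_closed _ (val a1) (val a2) (val a3) (val b1) (val b2) (val b3)).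
Qed.

Lemma quadric_configurationI F M N :
  #|` M| = d -> #|` N| = d -> [disjoint M & N] -> pairwise_skew M -> pairwise_skew N ->
  lines_on F M -> lines_on F N -> {in M & N, forall l m, meets l m} ->
  quadric_configuration d F (M `|` N).
Proof.
move=> cM cN dis skM skN onM onN MN; split; last by exists M, N.
  by rewrite cardfsU (eqP dis) cardfs0 cM cN; lia.
by move=> l; rewrite inE => /orP[/onM|/onN].
Qed.

Lemma double_2d_split (F : {mpoly k[4]}) A B :
  (2 < d)%N -> (10 < d)%N \/ (d < 5)%N ->
  double_2d d A B -> lines_on F A -> lines_on F B ->
  exists C C', [/\ quadric_configuration d F C, quadric_configuration d F C'
                 & A `|` B = C `|` C'].
Proof.
move=> d2 dr dbl onA onB; have AB := double_2d_disjoint dbl.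
have [[cA cB] [skA skB] degA degB] := dbl.
have [||a|b||//|//|S [S' [cS cS' SS' nSS']]] :=
  @closed_biregular_split A B (fun a b => meets (val a) (val b)) d.
- by rewrite -cardfE.
- by rewrite -cardfE.
- by rewrite -(degA _ (valP a)) card_fset_sep.
- by rewrite -(degB _ (valP b)) card_fset_sep; apply: eq_card => a; rewrite !inE meetsC.
- exact: meets_K33_closed.
(* Subsets of the finite types attached to [A] and [B] become finite sets of lines again. *)
pose im (E : {fset line k}) (X : {set E}) : {fset line k} := [fset val x | x in X].
have cardim (E : {fset line k}) (X : {set E}) : #|` im E X| = #|X| by apply: card_fset_val.
have imS (E : {fset line k}) (X : {set E}) : im E X `<=` E.
  by apply/fsubsetP => z /imfsetP[x _ ->]; apply: valP.
have imU (E : {fset line k}) (X : {set E}) : E = im E X `|` im E (~: X).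
  apply/eqP; rewrite eqEfsubset fsubUset !imS !andbT; apply/fsubsetP => z zE.
  have [zX|zX] := boolP ([` zE] \in X); rewrite inE; apply/orP; [left|right];
    by apply/imfsetP; exists [` zE]; rewrite ?inE.
have conf (X : {set A}) (X' : {set B}) : #|X| = d -> #|X'| = d ->
    {in X & X', forall (a : A) (b : B), meets (val a) (val b)} ->
    quadric_configuration d F (im A X `|` im B X').
  move=> cX cX' XX'; apply: quadric_configurationI; rewrite ?cardim //.
  - by apply: fdisjointWl (imS _ _) (fdisjointWr (imS _ _) AB).
  - exact: pairwise_skew_sub (imS _ _) skA.
  - exact: pairwise_skew_sub (imS _ _) skB.
  - by move=> l /(fsubsetP (imS _ _)); apply: onA.
  - by move=> l /(fsubsetP (imS _ _)); apply: onB.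
  - by move=> _ _ /imfsetP[a /= aX ->] /imfsetP[b /= bX ->]; apply: XX'.
exists (im A S `|` im B S'), (im A (~: S) `|` im B (~: S')); split.
- exact: conf.
- by apply: conf => //; rewrite cardsCs setCK -cardfE ?cA ?cB ?cS ?cS'; lia.
- by rewrite [in LHS](imU A S) [in LHS](imU B S') fsetUACA.
Qed.

(** * Uniqueness of the pair of quadrics *)

Lemma shared_ruling (Q R : {mpoly k[4]}) C M N :
  Q \is 2.-homog -> R \is 2.-homog -> Q != 0 -> R != 0 ->
  pairwise_skew M -> pairwise_skew N -> {in M & N, forall l m, meets l m} ->
  (2 < #|` M `&` C|)%N -> (2 < #|` N|)%N -> lines_on Q C -> lines_on R M ->
  same_surface Q R.
Proof.
move=> hQ hR Q0 R0 skM skN MN /fset_triple[a1 [a2 [a3 [[a12 a13 a23]]]]].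
rewrite !in_fsetI => -[/andP[a1M a1C] /andP[a2M a2C] /andP[a3M a3C]].
move=> /fset_triple[b1 [b2 [b3 [[b12 b13 b23] [b1N b2N b3N]]]]] onC onM.
apply: (@quadric_unique _ a1 a2 a3 b1 b2 b3) => //;
  try by [apply: skM | apply: skN | split; apply: onC | split; apply: onM].
by rewrite /allrel /= !MN.
Qed.

(** [defines_configuration] speaks of nonzero vectors, whereas [line_on] includes the apex of the
    cone. *)
Lemma homog2_vanishes0 (Q : {mpoly k[4]}) : Q \is 2.-homog -> vanishes_at Q 0.
Proof.
move=> /homog2_quad_mpoly[M ->].
by rewrite /vanishes_at meval_quad_mpoly /bilin !mul0mx mxE.
Qed.

Lemma defines_configuration_lines_on (F Q : {mpoly k[4]}) C :
  defines_configuration d F Q C -> lines_on Q C.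
Proof.
move=> [[_ hQ _] _ QC] l lC v vl; have [->|v0] := eqVneq v 0.
  exact: homog2_vanishes0.
by have [_ []] := QC v v0; first by exists l.
Qed.

Lemma same_surface_vanishes (Q R : {mpoly k[4]}) v :
  same_surface Q R -> vanishes_at Q v <-> vanishes_at R v.
Proof.
move=> [c c0 ->]; rewrite /vanishes_at mevalZ; split=> [->|/eqP]; first by rewrite mulr0.
by rewrite mulf_eq0 (negPf c0) => /eqP.
Qed.

Lemma same_surface_of_cover (F Q1 Q2 R : {mpoly k[4]}) C1 C2 D :
  (4 < d)%N -> defines_configuration d F Q1 C1 -> defines_configuration d F Q2 C2 ->
  defines_configuration d F R D -> D `<=` C1 `|` C2 ->
  same_surface Q1 R \/ same_surface Q2 R.
Proof.
move=> d5 def1 def2 defR sub.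
have [[Q10 hQ1 _] _ _] := def1; have [[Q20 hQ2 _] _ _] := def2.
have [[R0 hR _] [_ _ [M [N [DMN [cM cN] [skM skN] MN]]]] _] := defR.
have onM : lines_on R M.
  move=> l lM; apply: (defines_configuration_lines_on defR).
  by rewrite DMN inE lM.
have MN' : {in M & N, forall l m, meets l m} by move=> l m; apply: MN.
have N2 : (2 < #|` N|)%N by rewrite cN; lia.
(* Pigeonhole: the at least 5 lines of [M] are shared between [C1] and [C2], so one of these
   contains three of them. *)
have : (#|` M| <= #|` M `&` C1| + #|` M `&` C2|)%N.
  rewrite -(cardfsID C1 M) leq_add2l fsubset_leq_card //; apply/fsubsetP => l.
  rewrite !inE => /andP[lC1 lM]; rewrite lM /=.
  have /(fsubsetP sub) : l \in D by rewrite DMN inE lM.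
  by rewrite inE (negPf lC1).
rewrite cM => le_d; have [M1|M1] := ltnP 2 #|` M `&` C1|; [left|right].
  by apply: (shared_ruling _ _ _ _ skM skN MN' M1) => //; apply: defines_configuration_lines_on def1.
apply: (shared_ruling _ _ _ _ skM skN MN' (_ : (2 < #|` M `&` C2|)%N)) => //; first by lia.
exact: defines_configuration_lines_on def2.
Qed.

End DoubleConfigurations.

(** Proportional quadrics cut the same points on the surface, so each line of [D1] is covered by the
    finitely many lines of [D2] and is one of them. *)
Lemma defines_configuration_inj (k : closedFieldType) (d : nat) (F Q R1 R2 : {mpoly k[4]})
    (D1 D2 : {fset line k}) :
  defines_configuration d F R1 D1 -> defines_configuration d F R2 D2 ->
  same_surface Q R1 -> same_surface Q R2 -> D1 `<=` D2.
Proof.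
move=> [_ _ def1] [_ _ def2] s1 s2; apply/fsubsetP => l lD1.
apply: (@line_cover _ l (enum_fset D2)) => v v0 vl.
have [_ [|Fv R1v]] := def1 v v0; first by exists l.
have [cov _] := def2 v v0; have [|m mD2 vm] := cov; last by exists m.
by split=> //; apply/(same_surface_vanishes _ s2)/(same_surface_vanishes _ s1).
Qed.

Lemma same_pair_of_double_2d (k : closedFieldType) (d : nat) (F : {mpoly k[4]})
    (A B : {fset line k}) (Q1 Q2 R1 R2 : {mpoly k[4]}) :
  (4 < d)%N -> double_2d d A B ->
  pair_determines d F Q1 Q2 A B -> pair_determines d F R1 R2 A B ->
  same_pair Q1 Q2 R1 R2.
Proof.
move=> d5 dbl [C1 [C2 [defC1 defC2 ABC]]] [D1 [D2 [defD1 defD2 ABD]]].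
have CD : C1 `|` C2 = D1 `|` D2 by rewrite -ABC.
(* Otherwise [D1] would lie in [D2], leaving 2d lines for the union of [A] and [B], which has 4d. *)
have ndef Q : same_surface Q R1 -> same_surface Q R2 -> False.
  move=> s1 s2; have sub := defines_configuration_inj defD1 defD2 s1 s2.
  have [[cA cB] _ _ _] := dbl; have [_ [cD2 _ _] _] := defD2.
  have := congr1 (fun S : {fset line k} => #|` S|) ABD.
  rewrite (fsetUidPr _ _ sub) cD2 cardfsU (eqP (double_2d_disjoint dbl)) cardfs0 cA cB.
  by lia.
have sub1 : D1 `<=` C1 `|` C2 by rewrite CD fsubsetUl.
have sub2 : D2 `<=` C1 `|` C2 by rewrite CD fsubsetUr.
have [s1|s1] := same_surface_of_cover d5 defC1 defC2 defD1 sub1;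
  have [s2|s2] := same_surface_of_cover d5 defC1 defC2 defD2 sub2.
- by case: (ndef _ s1 s2).
- by left.
- by right.
- by case: (ndef _ s1 s2).
Qed.

Theorem theorem6p0p4 (k : closedFieldType) (p : nat) (hp : p \in [pchar k])
    (d : nat) (F : {mpoly k[4]})
    (hX : extremal_surface p d F) (hsm : smooth_surface F) :
  ((10 < d)%N \/ (d < 5)%N ->
    forall A B : {fset line k},
      double_2d d A B -> lines_on F A -> lines_on F B ->
      exists C C' : {fset line k},
        [/\ quadric_configuration d F C,
            quadric_configuration d F C'
          & A `|` B = C `|` C'])
  /\
  ((5 <= d)%N ->
    forall A B : {fset line k},
      double_2d d A B -> lines_on F A -> lines_on F B ->
      forall Q1 Q2 R1 R2 : {mpoly k[4]},
        pair_determines d F Q1 Q2 A B ->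
        pair_determines d F R1 R2 A B ->
        same_pair Q1 Q2 R1 R2).
Proof.
split=> [dr A B dbl onA onB|d5 A B dbl _ _ Q1 Q2 R1 R2].
  (* Since p >= 2 and e >= 1, the degree p^e + 1 is at least 3. *)
  have d2 : (2 < d)%N.
    have [_ [e [e0 -> _]]] := hX; have p2 := prime_gt1 (pcharf_prime hp).
    by rewrite ltnS (leq_trans p2) // -{1}(expn1 p) leq_pexp2l // ltnW.
  exact: double_2d_split.
exact: same_pair_of_double_2d.
Qed.
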